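(* Let $r\ge1$, $\mathbf n=(n_1,\dots,n_r)\in\mathbb N_0^r$, $\mathbf a,\mathbf b\in\mathbb R^{r+1}$, $\mathbf x\in\mathbb C^r$, such that no lower parameter of the ${}_3F_2$'s occurring below is a nonpositive integer and no denominator below vanishes. Then $$\begin{aligned}&E_0\;{}_rS_{\mathbf n}(\mathbf x;\mathbf a,\mathbf b)+E_1\;{}_rS_{\mathbf n}(\mathbf x;\mathbf a,b_1,\dots,b_{r-1},b_r-1,b_{r+1}+1)\\&\quad+E_2\;{}_rS_{\mathbf n}(\mathbf x;\mathbf a,b_1,\dots,b_{r-1},b_r-2,b_{r+1}+2)=0,\end{aligned}$$ where $$E_0=-\frac{b_r-1+\frac{x_r}{2}}{a_{r+1}+b_{r+1}-1},$$ $$\begin{aligned}E_1=&\;\frac{n_r\big(n_r+|\mathbf a^r|+|\mathbf b^r|-1\big)-\big(a_{r+1}+\frac{x_r}{2}\big)\big(|\mathbf a^r|+|\mathbf b^r|-1\big)}{(a_{r+1}+b_{r+1}-1)_2}\\&+\frac{(2a_{r+1}+2b_{r+1}+1)\big(|\mathbf a^r|+b_r-2+\frac{x_r}{2}\big)}{(a_{r+1}+b_{r+1}-1)_2}-\frac{|\mathbf a^r|-1}{a_{r+1}+b_{r+1}-1},\end{aligned}$$ $$E_2=-\frac{(n_r+a_r+b_r-2)(n_r+a_{r+1}+b_{r+1}+1)\big(b_{r+1}-\frac{x_r}{2}+1\big)}{(a_{r+1}+b_{r+1}-1)_3}.$$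
   Context: Notation: $(c)_k=c(c+1)\cdots(c+k-1)$, $(c)_0=1$; ${}_3F_2\left(\begin{matrix}c_1,c_2,c_3\\ d_1,d_2\end{matrix}\Big|z\right)=\sum_{k\ge0}\frac{(c_1)_k(c_2)_k(c_3)_k}{(d_1)_k(d_2)_k}\frac{z^k}{k!}$ (a finite sum when $c_1=-n$, $n\in\mathbb N_0=\{0,1,\dots\}$). For $r\ge1$, $\mathbf n=(n_1,\dots,n_r)$, $\mathbf a=(a_1,\dots,a_{r+1})$, $\mathbf b=(b_1,\dots,b_{r+1})$: $|\mathbf n^j|=n_j+\cdots+n_r$ with $|\mathbf n^{r+1}|=0$, $|\mathbf a^j|=a_j+\cdots+a_{r+1}$, $|\mathbf b^j|=b_j+\cdots+b_{r+1}$. For $\mathbf x=(x_1,\dots,x_r)$, $${}_rS_{\mathbf n}(\mathbf x;\mathbf a,\mathbf b)=\prod_{j=1}^r\left\{\Big(|\mathbf a^{j+1}|+\frac{x_j}{2}\Big)_{|\mathbf n^{j+1}|}\;{}_3F_2\left(\begin{matrix}-n_j,\;n_j+2|\mathbf n^{j+1}|+|\mathbf a^j|+|\mathbf b^j|-1,\;|\mathbf n^{j+1}|+|\mathbf a^{j+1}|+\frac{x_j}{2}\\ 2|\mathbf n^{j+1}|+|\mathbf a^{j+1}|+|\mathbf b^{j+1}|,\;|\mathbf n^{j+1}|+|\mathbf a^j|\end{matrix}\,\Big|\,1\right)\right\}.$$ *)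

(* Defs.v *)
From mathcomp Require Import all_boot all_order all_algebra.
From mathcomp Require Import all_classical reals topology normedtype sequences.
From mathcomp Require Import complex.

Set Implicit Arguments.
Unset Strict Implicit.
Unset Printing Implicit Defensive.

Import Order.TTheory GRing.Theory Num.Theory.
Import numFieldNormedType.Exports.

Local Open Scope ring_scope.
Local Open Scope complex_scope.

Definition pochhammer (K : pzRingType) (c : K) (k : nat) : K :=
  \prod_(i < k) (c + i%:R).

(* The series converges in all uses below, since it terminates when c1 = - n%:R. *)
Definition hypergeometric3F2 (K : numFieldType) (c1 c2 c3 d1 d2 z : K) : K :=
  limn (series (fun k : nat =>
    pochhammer c1 k * pochhammer c2 k * pochhammer c3 k
      / (pochhammer d1 k * pochhammer d2 k) * (z ^+ k / k`!%:R))).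

(* With indices counted from 0, tail_sum v j is the quantity |v^(j+1)| of the
   1-based convention; it is 0 when j is the length of v. *)
Definition tail_sum (V : nmodType) (m : nat) (v : 'I_m -> V) (j : nat) : V :=
  \sum_(i < m | (j <= i)%N) v i.

Section MultivariateS.
Variables (R : realType) (r : nat).
Implicit Types (n : 'I_r -> nat) (x : 'I_r -> R[i]) (a b : 'I_r.+1 -> R).

Definition lower1 n a b (j : 'I_r) : R :=
  2 * (tail_sum n j.+1)%:R + tail_sum a j.+1 + tail_sum b j.+1.

Definition lower2 n a (j : 'I_r) : R :=
  (tail_sum n j.+1)%:R + tail_sum a j.

Definition multiS n x a b : R[i] :=
  \prod_(j < r)
    (pochhammer ((tail_sum a j.+1)%:C + x j / 2) (tail_sum n j.+1)
     * hypergeometric3F2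
         (- (n j)%:R)
         ((n j)%:R + 2 * (tail_sum n j.+1)%:R
            + (tail_sum a j)%:C + (tail_sum b j)%:C - 1)
         ((tail_sum n j.+1)%:R + (tail_sum a j.+1)%:C + x j / 2)
         (lower1 n a b j)%:C
         (lower2 n a j)%:C
         1).

Definition not_nonpos_int (d : R) : Prop := forall k : nat, d != - k%:R.

Definition admissible n a b : Prop :=
  forall j : 'I_r, not_nonpos_int (lower1 n a b j) /\ not_nonpos_int (lower2 n a j).

End MultivariateS.

(* Below, r = m.+1 >= 1: x_r is x ord_max, while a_r and a_{r+1} are
   a (inord m) and a ord_max. *)
Section Coefficients.
Variables (R : realType) (m : nat).
Implicit Types (n : 'I_m.+1 -> nat) (x : 'I_m.+1 -> R[i]) (a b : 'I_m.+2 -> R).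

Definition penult (v : 'I_m.+2 -> R) : R := v (inord m).

(* (b_1, ..., b_{r-1}, b_r - t, b_{r+1} + t) *)
Definition shift_last (t : R) b : 'I_m.+2 -> R := fun i =>
  if i == ord_max then b i + t else if i == inord m then b i - t else b i.

Definition coefE0 x a b : R[i] :=
  - (((penult b)%:C - 1 + x ord_max / 2) / ((a ord_max)%:C + (b ord_max)%:C - 1)).

Definition coefE1 n x a b : R[i] :=
  let N : R[i] := (n ord_max)%:R in
  let A : R[i] := (tail_sum a m)%:C in
  let B : R[i] := (tail_sum b m)%:C in
  let a' : R[i] := (a ord_max)%:C in
  let b' : R[i] := (b ord_max)%:C in
  let br : R[i] := (penult b)%:C in
  let h : R[i] := x ord_max / 2 in
  (N * (N + A + B - 1) - (a' + h) * (A + B - 1)) / pochhammer (a' + b' - 1) 2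
  + (2 * a' + 2 * b' + 1) * (A + br - 2 + h) / pochhammer (a' + b' - 1) 2
  - (A - 1) / (a' + b' - 1).

Definition coefE2 n x a b : R[i] :=
  let N : R[i] := (n ord_max)%:R in
  let a' : R[i] := (a ord_max)%:C in
  let b' : R[i] := (b ord_max)%:C in
  let ar : R[i] := (penult a)%:C in
  let br : R[i] := (penult b)%:C in
  let h : R[i] := x ord_max / 2 in
  - ((N + ar + br - 2) * (N + a' + b' + 1) * (b' - h + 1)
      / pochhammer (a' + b' - 1) 3).

End Coefficients.

(* Main.v *)
(** The parameters b_r and b_(r+1) enter the product only through b_r + b_(r+1),
    except in the lower parameter d = a_(r+1) + b_(r+1) of its last factor. Hence
    the identity is a contiguous relation between the 3F2 series with lower
    parameters d, d + 1 and d + 2, which creative telescoping proves: if u k is the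
    k-th term of the series for d + 2, the k-th term of the combination is
    G (k + 1) - G k with, for A = a_r + a_(r+1),
    G k = - k (A + k - 1) (d + 1 + k) u k / ((d - 1) d (d + 1)). *)

Require Import Defs.
From mathcomp Require Import all_boot all_order all_algebra.
From mathcomp Require Import all_classical reals topology normedtype sequences.
From mathcomp Require Import complex.
From mathcomp Require Import ring.

Import Order.TTheory GRing.Theory Num.Theory.
Import numFieldNormedType.Exports.
Local Open Scope ring_scope.

(** * Terminating 3F2 series at 1 and their contiguous relation *)

Lemma pochhammer0 {K : pzRingType} (c : K) : pochhammer c 0 = 1.
Proof. exact: big_ord0. Qed.

Lemma pochhammerSr {K : pzRingType} (c : K) (k : nat) :
  pochhammer c k.+1 = pochhammer c k * (c + k%:R).
Proof. by rewrite /pochhammer big_ord_recr. Qed.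

Lemma pochhammerSl {K : pzRingType} (c : K) (k : nat) :
  pochhammer c k.+1 = c * pochhammer (c + 1) k.
Proof.
rewrite /pochhammer big_ord_recl addr0; congr (_ * _).
by apply: eq_bigr => i _; rewrite /= /bump leq0n natrD addrA.
Qed.

Lemma pochhammer_oppn_eq0 {K : pzRingType} (n k : nat) :
  (n < k)%N -> pochhammer (- n%:R : K) k = 0.
Proof.
elim: k => // k IHk; rewrite ltnS leq_eqVlt pochhammerSr => /orP[/eqP <-|/IHk ->].
  by rewrite addNr mulr0.
by rewrite mul0r.
Qed.

Definition term3F2 {K : numFieldType} (c1 c2 c3 d1 d2 : K) (k : nat) : K :=
  pochhammer c1 k * pochhammer c2 k * pochhammer c3 k
    / (pochhammer d1 k * pochhammer d2 k) / k`!%:R.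

Lemma term3F2S {K : numFieldType} (c1 c2 c3 d1 d2 : K) (k : nat) :
  term3F2 c1 c2 c3 d1 d2 k.+1 =
  term3F2 c1 c2 c3 d1 d2 k * ((c1 + k%:R) * (c2 + k%:R) * (c3 + k%:R))
    / ((d1 + k%:R) * (d2 + k%:R) * k.+1%:R).
Proof.
rewrite /term3F2 !pochhammerSr factS natrM !invfM.
ring.
Qed.

(** Both sides of (d)_k (d + k) = d (d + 1)_k are (d)_(k+1). This brings terms with different lower
    parameters to a common one, at the cost of a factor rational in k. *)
Lemma term3F2_lower1S {K : numFieldType} (c1 c2 c3 d1 d2 : K) (k : nat) :
  d1 != 0 -> d1 + k%:R != 0 ->
  term3F2 c1 c2 c3 d1 d2 k =
  term3F2 c1 c2 c3 (d1 + 1) d2 k * ((d1 + k%:R) / d1).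
Proof.
move=> d0 dk.
have inv : (pochhammer d1 k)^-1 = (pochhammer (d1 + 1) k)^-1 * ((d1 + k%:R) / d1).
  apply: (mulIf (invr_neq0 dk)); rewrite -invfM -pochhammerSr pochhammerSl invfM.
  by move: (pochhammer (d1 + 1) k)^-1 => q; field; rewrite d0 dk.
rewrite /term3F2 !invfM inv; ring.
Qed.

(** The partial sums are constant from index [n.+1] on. *)
Lemma series_eventually0 {K : numFieldType} (u : nat -> K) (n : nat) :
  (forall k, (n < k)%N -> u k = 0) -> limn (series u) = \sum_(k < n.+1) u k.
Proof.
move=> u0; apply/cvg_lim; first exact: norm_hausdorff.
apply: cvg_near_cst; exists n.+1 => // N /= ltnN; apply/eqP.
rewrite /series /= (big_cat_nat _ ltnN) //= big_mkord.
by rewrite [X in _ + X]big_nat [X in _ + X]big1 ?addr0 // => k /andP[/u0 ->].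
Qed.

Lemma hypergeometric3F2_oppn {K : numFieldType} (n : nat) (c2 c3 d1 d2 : K) :
  hypergeometric3F2 (- n%:R) c2 c3 d1 d2 1 =
  \sum_(k < n.+1) term3F2 (- n%:R) c2 c3 d1 d2 k.
Proof.
rewrite /hypergeometric3F2 (@series_eventually0 _ _ n).
  by apply: eq_bigr => k _; rewrite expr1n div1r.
by move=> k ltnk; rewrite pochhammer_oppn_eq0 // !mul0r.
Qed.

(** Here [a, a', b, b', h] stand for a_r, a_(r+1), b_r, b_(r+1), x_r/2. Starting the last hypothesis
    at [d - 1] covers the denominators of the coefficients together with the lower parameters [d],
    [d + 1] and [d + 2]. *)
Lemma hypergeometric3F2_contiguous {K : numFieldType} (n : nat)
    (a a' b b' h : K) :
  let A := a + a' in
  let B := b + b' in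
  let d := a' + b' in
  let F e := hypergeometric3F2 (- n%:R) (n%:R + A + B - 1) (a' + h) e A 1 in
  (forall i : nat, A + i%:R != 0) ->
  (forall i : nat, d - 1 + i%:R != 0) ->
  - ((b - 1 + h) / (d - 1)) * F d
  + ((n%:R * (n%:R + A + B - 1) - (a' + h) * (A + B - 1)) / pochhammer (d - 1) 2
     + (2 * a' + 2 * b' + 1) * (A + b - 2 + h) / pochhammer (d - 1) 2
     - (A - 1) / (d - 1)) * F (d + 1)
  + - ((n%:R + a + b - 2) * (n%:R + a' + b' + 1) * (b' - h + 1)
      / pochhammer (d - 1) 3) * F (d + 2) = 0.
Proof.
move=> A B d F A0 d0.
have dN (k : nat) : d + k%:R != 0.
  by have := d0 k.+1; rewrite -natr1 addrCA subrK addrC.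
have dm0 : d - 1 != 0 by have := d0 0; rewrite addr0.
have d00 : d != 0 by have := dN 0; rewrite addr0.
have d10 : d + 1 != 0 := dN 1.
have p2 : pochhammer (d - 1) 2 = (d - 1) * d.
  by rewrite !pochhammerSr pochhammer0 mul1r addr0 subrK.
have p3 : pochhammer (d - 1) 3 = (d - 1) * d * (d + 1).
  by rewrite pochhammerSr p2 (natrD _ 1 1) addrA subrK.
rewrite p2 p3 /F !hypergeometric3F2_oppn.
set s := n%:R + A + B - 1; set c := a' + h.
set u := term3F2 (- n%:R) s c (d + 2) A.
pose G (k : nat) :=
  - (k%:R * (A + k%:R - 1) * (d + 1 + k%:R) * u k / ((d - 1) * d * (d + 1))).
have G0 : G 0 = 0 by rewrite /G !mul0r oppr0.
(* The upper end vanishes because (-n)_(n+1) = 0, the lower end because of the factor k in [G]. *)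
have GS : G n.+1 = 0.
  by rewrite /G /u /term3F2 pochhammer_oppn_eq0 // !(mul0r, mulr0) oppr0.
have telG : \sum_(k < n.+1) (G k.+1 - G k) = 0.
  by rewrite -(big_mkord predT (fun k => G k.+1 - G k)) telescope_sumr //
     GS G0 subrr.
rewrite !mulr_sumr -!big_split /= -[RHS]telG.
apply: eq_bigr => k _.
(* The first rewrite moves the term at [d] to [d + 1]; the second moves both terms at [d + 1] to
   [d + 2]. *)
rewrite (term3F2_lower1S _ _ _ d) // (term3F2_lower1S _ _ _ (d + 1)) //; last first.
  by rewrite -addrA -[1 + _](natrD _ 1).
rewrite -(addrA d) -[1 + 1]/(2 : K) -/u /G.
(* The term ratio makes [u k.+1] a multiple of [u k]; once [u k] is a free variable, a rational
   identity remains. *)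
rewrite [u k.+1]term3F2S -/(u k).
move: (u k) => uk; clear u G G0 GS telG F.
have k1 : 1 + k%:R != 0 :> K by rewrite nat1r pnatr_eq0.
have dk2 : d + 2 + k%:R != 0 by rewrite -addrA -natrD.
move: (A0 k) (dN k) dk2; rewrite /s /c /A /B /d in dm0 d00 d10 *.
move=> Ak dk dk2; field.
by rewrite d10 d00 dm0 k1 Ak dk2.
Qed.

(** * Effect of the shift on tail sums and on the factors of [multiS] *)

Lemma tail_sum_size {V : nmodType} (m : nat) (v : 'I_m -> V) : tail_sum v m = 0.
Proof. by rewrite /tail_sum big1 // => i; rewrite leqNgt ltn_ord. Qed.

Lemma tail_sumS {V : nmodType} (m j : nat) (v : 'I_m.+1 -> V) :
  (j <= m)%N -> tail_sum v j =
  tail_sum (fun i : 'I_m => v (widen_ord (leqnSn m) i)) j + v ord_max.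
Proof.
by move=> lejm; rewrite /tail_sum big_mkcond big_ord_recr /= lejm -big_mkcond.
Qed.

Lemma tail_sum_last {V : nmodType} (m : nat) (v : 'I_m.+1 -> V) :
  tail_sum v m = v ord_max.
Proof. by rewrite tail_sumS // tail_sum_size add0r. Qed.

Lemma widen_ord_max (m : nat) :
  widen_ord (leqnSn m.+1) ord_max = inord m :> 'I_m.+2.
Proof. by apply/val_inj; rewrite /= inordK. Qed.

Section ShiftLast.
Variables (R : realType) (m : nat).
Implicit Types (n : 'I_m.+1 -> nat) (x : 'I_m.+1 -> R[i]) (a b : 'I_m.+2 -> R).

Lemma tail_sum_penult b : tail_sum b m = penult b + b ord_max.
Proof. by rewrite tail_sumS // tail_sum_last widen_ord_max. Qed.

Lemma shift_last0 b : shift_last 0 b = b.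
Proof.
by apply/funext => i; rewrite /shift_last addr0 subr0; do 2 case: ifP => // _.
Qed.

Lemma shift_last_max t b : shift_last t b ord_max = b ord_max + t.
Proof. by rewrite /shift_last eqxx. Qed.

(** A tail that starts at b_r or earlier contains both changed entries, so [- t] and [+ t]
    cancel. *)
Lemma tail_sum_shift_last t b (j : nat) :
  (j <= m)%N -> tail_sum (shift_last t b) j = tail_sum b j.
Proof.
move=> lejm; rewrite !(tail_sumS m.+1) ?leqW // !(tail_sumS m) //.
rewrite widen_ord_max shift_last_max /shift_last eqxx.
case: eqP => [/(congr1 val)|_]; first by rewrite /= inordK // => /n_Sn.
rewrite -!addrA; congr (_ + (_ + _)); last by rewrite addrC addrK.
(* The remaining entries have index below [m], hence are neither b_r nor b_(r+1). *)
apply: eq_bigr => i _; rewrite !ifF //; apply/negbTE/eqP => /(congr1 val) /=.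
  by rewrite inordK // => im; have := ltn_ord i; rewrite im ltnn.
by move=> im; have := ltn_ord i; rewrite im ltnNge leqnSn.
Qed.

(** Repeats the body of the product in [multiS], so that the two agree by conversion. *)
Definition multiS_factor n x a b (j : 'I_m.+1) : R[i] :=
  pochhammer ((tail_sum a j.+1)%:C%C + x j / 2) (tail_sum n j.+1)
  * hypergeometric3F2
      (- (n j)%:R)
      ((n j)%:R + 2 * (tail_sum n j.+1)%:R
         + (tail_sum a j)%:C%C + (tail_sum b j)%:C%C - 1)
      ((tail_sum n j.+1)%:R + (tail_sum a j.+1)%:C%C + x j / 2)
      (lower1 n a b j)%:C%C
      (lower2 n a j)%:C%C
      1.

Lemma multiS_factor_shift_last n x a b t (j : 'I_m) :
  multiS_factor n x a (shift_last t b) (widen_ord (leqnSn m) j) =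
  multiS_factor n x a b (widen_ord (leqnSn m) j).
Proof.
have ltjm : (j < m)%N := ltn_ord j.
by rewrite /multiS_factor /lower1 !tail_sum_shift_last // ltnW.
Qed.

(** The tail of [n] beyond the last index is empty, which makes the Pochhammer prefactor 1; [t]
    survives only in the first lower parameter, where b_(r+1) stands without b_r. *)
Lemma multiS_factor_max n x a b t :
  multiS_factor n x a (shift_last t b) ord_max =
  hypergeometric3F2
    (- (n ord_max)%:R)
    ((n ord_max)%:R + (tail_sum a m)%:C%C + (tail_sum b m)%:C%C - 1)
    ((a ord_max)%:C%C + x ord_max / 2)
    ((a ord_max)%:C%C + (b ord_max)%:C%C + t%:C%C)
    (tail_sum a m)%:C%C
    1.
Proof.
rewrite /multiS_factor /lower1 /lower2.
rewrite -[nat_of_ord ord_max]/m tail_sum_size.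
rewrite pochhammer0 mul1r !mulr0 !add0r addr0.
rewrite (tail_sum_shift_last _ _ _ (leqnn m)) !tail_sum_last shift_last_max.
have -> : (a ord_max + (b ord_max + t))%:C%C =
    (a ord_max)%:C%C + (b ord_max)%:C%C + t%:C%C by rewrite !rmorphD addrA.
by [].
Qed.

Lemma multiS_shift_last n x a b t :
  multiS n x a (shift_last t b) =
  \prod_(j < m) multiS_factor n x a b (widen_ord (leqnSn m) j)
  * hypergeometric3F2
      (- (n ord_max)%:R)
      ((n ord_max)%:R + (tail_sum a m)%:C%C + (tail_sum b m)%:C%C - 1)
      ((a ord_max)%:C%C + x ord_max / 2)
      ((a ord_max)%:C%C + (b ord_max)%:C%C + t%:C%C)
      (tail_sum a m)%:C%C
      1.
Proof.
rewrite -multiS_factor_max.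
have -> : multiS n x a (shift_last t b) =
    \prod_(j < m.+1) multiS_factor n x a (shift_last t b) j by [].
rewrite big_ord_recr.
apply: (f_equal2 *%R); last by [].
by apply: eq_bigr => j _; rewrite multiS_factor_shift_last.
Qed.

End ShiftLast.

Theorem theorem5p18 (R : realType) (m : nat)
    (n : 'I_m.+1 -> nat) (a b : 'I_m.+2 -> R) (x : 'I_m.+1 -> R[i])
    (hlow0 : admissible n a b)
    (hlow1 : admissible n a (shift_last 1 b))
    (hlow2 : admissible n a (shift_last 2 b))
    (hden1 : a ord_max + b ord_max - 1 != 0)
    (hden2 : pochhammer (a ord_max + b ord_max - 1) 2 != 0)
    (hden3 : pochhammer (a ord_max + b ord_max - 1) 3 != 0) :
  coefE0 x a b * multiS n x a b
  + coefE1 n x a b * multiS n x a (shift_last 1 b)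
  + coefE2 n x a b * multiS n x a (shift_last 2 b) = 0.
Proof.
have A0 (k : nat) : penult a + a ord_max + k%:R != 0.
  have [_ /(_ k)] := hlow0 ord_max; rewrite /lower2 /= tail_sum_size add0r.
  by rewrite tail_sum_penult addr_eq0.
have d0 (k : nat) : a ord_max + b ord_max - 1 + k%:R != 0.
  case: k => [|k]; first by rewrite addr0.
  (* For [k.+1] the value is d + k with d = a_(r+1) + b_(r+1), the first lower parameter of the last
     factor. *)
  have [/(_ k) + _] := hlow0 ord_max.
  rewrite /lower1 /= tail_sum_size mulr0 add0r !tail_sum_last.
  by rewrite -natr1 addrCA subrK addrC addr_eq0.
(* Nonvanishing passes to the complex numbers along the injective morphism [real_complex]. *)
have A0C (k : nat) : (penult a)%:C%C + (a ord_max)%:C%C + k%:R != 0 :> R[i].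
  by have := A0 k; rewrite -(fmorph_eq0 (real_complex R)) !rmorphD rmorph_nat.
have d0C (k : nat) : (a ord_max)%:C%C + (b ord_max)%:C%C - 1 + k%:R != 0 :> R[i].
  have := d0 k; rewrite -(fmorph_eq0 (real_complex R)).
  by rewrite !rmorphD rmorphN rmorph1 rmorph_nat.
have := hypergeometric3F2_contiguous (n ord_max) _ _ (penult b)%:C%C _
  (x ord_max / 2) A0C d0C.
have penultC (v : 'I_m.+2 -> R) :
    (tail_sum v m)%:C%C = (penult v)%:C%C + (v ord_max)%:C%C :> R[i].
  by rewrite tail_sum_penult rmorphD.
(* The unshifted value is the case [t = 0], so all three share the product over the first [m]
   factors, which is then pulled out. *)
have := multiS_shift_last _ _ n x a b 0; rewrite shift_last0 => ->.
rewrite !multiS_shift_last /coefE0 /coefE1 /coefE2 !penultC.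
have -> : 0%:C%C = 0 :> R[i] by rewrite rmorph0.
have -> : 1%:C%C = 1 :> R[i] by rewrite rmorph1.
have -> : 2%:C%C = 2 :> R[i] by rewrite rmorph_nat.
rewrite addr0; move: (\prod_(j < m) _) => P; cbv zeta.
move: (hypergeometric3F2 _ _ _) => F contiguous.
rewrite ![_ * (P * _)]mulrCA -!(mulrDr P) -[RHS](mulr0 P); congr (_ * _).
exact: contiguous.
Qed.
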